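(* Any group $G$ is contained (as a subgroup) in a group $\mathcal{G}$ acting sharply $2$-transitively on a set $X$ such that each involution in $\mathcal{G}$ has no fixed point in $X$, and such that $\mathcal{G}$ does not contain a non-trivial abelian normal subgroup.
   Context: An involution is an element of order exactly $2$. A group $\mathcal{G}$ acts sharply $2$-transitively on a set $X$ if it is transitive on $X$ and for any two ordered pairs $(x_1,x_2),(x_1',x_2')\in X\times X$ of distinct points (i.e. $x_1\ne x_2$, $x_1'\neq x_2'$) there exists a unique $g\in \mathcal{G}$ with $x_ig=x_i'$ for $i=1,2$. The set $X$ is understood to have at least two points. *)

(* Defs.v *)
From mathcomp Require Import all_boot.
From mathcomp Require Import boolp classical_sets.

Set Implicit Arguments.
Unset Strict Implicit.
Unset Printing Implicit Defensive.

Local Open Scope classical_set_scope.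
Local Open Scope group_scope.

(* [groupType] also covers infinite groups, but the library's element orders,
   normal subgroups and actions are restricted to finite groups, hence the
   definitions below. *)

Section GroupNotions.
Variable H : groupType.
Implicit Types (g : H) (N : set H) (n : nat).

Definition has_order g n : Prop :=
  [/\ (0 < n)%N, g ^+ n = 1 & forall m, (0 < m < n)%N -> g ^+ m <> 1].

Definition involution g : Prop := has_order g 2.

Definition normal_subgroup N : Prop :=
  group_closed [in N] /\ (forall x g, N x -> N (x ^ g)).

Definition abelian_subset N : Prop := forall x y, N x -> N y -> commute x y.

Definition nontrivial_subgroup N : Prop := N <> [set 1].

End GroupNotions.

Section RightActions.
Variables (H : groupType) (X : Type) (act : X -> H -> X).

Definition right_action : Prop :=
  (forall x, act x 1 = x) /\ (forall x g h, act x (g * h) = act (act x g) h).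

Definition transitive_action : Prop := forall x y, exists g, act x g = y.

Definition sharply_2_transitive : Prop :=
  [/\ right_action,
      exists x y : X, x <> y,
      transitive_action &
      forall x1 x2 y1 y2 : X, x1 <> x2 -> y1 <> y2 ->
        exists! g, act x1 g = y1 /\ act x2 g = y2].

End RightActions.

(* Main.v *)
Require Import Defs.
From HB Require Import structures.
From mathcomp Require Import all_boot perm.
From mathcomp Require Import boolp classical_sets.

Set Implicit Arguments.
Unset Strict Implicit.
Unset Printing Implicit Defensive.

Local Open Scope group_scope.

(** Call an action tame if a non-trivial element fixes at most one point and
    no involution fixes a point.  The group is obtained as the limit of a
    sequence of tame actions, each one embedded in the next, that starts with
    the regular action of G x S_3 and in which any two pairs of distinct points
    of one stage become equivalent at the next.

    One step (extension_step).  Let G act tamely on X and let s0 be an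
    involution swapping two points x0, y0.  In every other G-orbit of unordered
    pairs choose a pair {x_i, y_i}; a new element f_i is to carry (x0, y0) to
    (x_i, y_i).  If some s_i in G swaps x_i and y_i, then f_i must conjugate s0
    to s_i, because s_i is the only element that may swap this pair; otherwise
    f_i is subject to no relation.  So the new group is a multiple HNN
    extension of G with associated subgroups of order at most 2, and it acts on
    the free completion of the partial maps f_i: whenever f_i or its inverse is
    undefined at a point, a new point is added, together with a regular G-orbit
    around it.  No normal form theorem for HNN extensions is used.  The points
    of the completion are themselves normal forms (node, valid), and the group
    is defined as the group of permutations generated by G and the f_i.

    Why the new action is tame.  Outside X, the completion is a forest whose
    vertices are regular G-orbits.  Every element is conjugate to an element of
    G or to a non-empty cyclically reduced word (tame_word_sym).  A closed path
    that follows a cyclically reduced word never turns back in the forest;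
    hence it cannot leave X (closed_stays_low).  If such a word fixed two
    points, the path of this pair would run through the pairs {x0, y0} and
    {x_i, y_i} only; these lie in distinct G-orbits, so after reaching
    {x_i, y_i} through f_i the path leaves by the inverse of f_i, and the
    element of G between the two letters is 1 or s_i, which is a cancellation
    (straight_fixes_one).  Consequently a cyclically reduced word is not an
    involution either: its square is cyclically reduced and would fix all
    points.

    The limit.  Permutations of the union that are induced by group elements at
    all late stages form a group, and it acts sharply 2-transitively with
    fixed-point-free involutions, since these properties are decided at finite
    stages.

    Normal subgroups (no_abelian_normal_subgroup).  In such a group an abelian
    normal subgroup N <> 1 is regular.  Given s with s^2 = 1, let m in N agree
    with s at a point p.  Then s m^-1 fixes p, and so does its square, which
    lies in N and is thus 1; by freeness of involutions s = m.  Hence N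
    contains all involutions, and they commute, unlike those of S_3. *)

(** * Groups of permutations of an arbitrary type *)

(** Products are composed from left to right, so that evaluation is a right
    action. *)
Record sym (X : Type) := MakeSym {
  sym_fun :> X -> X;
  sym_inv : X -> X;
  sym_funK : cancel sym_fun sym_inv;
  sym_invK : cancel sym_inv sym_fun }.

Section SymGroup.
Variable X : Type.
Implicit Types s t u : sym X.

Lemma sym_ext s t : s =1 t -> s = t.
Proof.
case: s t => [f f' fK f'K] [g g' gK g'K] /= /funext efg.
move: fK f'K; rewrite efg => fK f'K.
have e' : f' = g' by apply/funext => x; rewrite -{1}[x]g'K fK.
by move: fK f'K; rewrite e' => fK f'K; congr MakeSym; apply: Prop_irrelevance.
Qed.

HB.instance Definition _ := gen_eqMixin (sym X).
HB.instance Definition _ := gen_choiceMixin (sym X).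

Definition sym_one : sym X := @MakeSym X id id (fun=> erefl) (fun=> erefl).
Definition sym_opp s : sym X := MakeSym (@sym_invK X s) (@sym_funK X s).
Definition sym_mul s t : sym X :=
  MakeSym (can_comp (@sym_funK X t) (@sym_funK X s))
      (can_comp (@sym_invK X s) (@sym_invK X t)).

Fact sym_mulA : associative sym_mul.
Proof. by move=> s t u; apply: sym_ext. Qed.
Fact sym_mul1 : left_id sym_one sym_mul.
Proof. by move=> s; apply: sym_ext. Qed.
Fact sym_1mul : right_id sym_one sym_mul.
Proof. by move=> s; apply: sym_ext. Qed.
Fact sym_mulV : left_inverse sym_one sym_opp sym_mul.
Proof. by move=> s; apply: sym_ext => x /=; rewrite sym_invK. Qed.
Fact sym_Vmul : right_inverse sym_one sym_opp sym_mul.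
Proof. by move=> s; apply: sym_ext => x /=; rewrite sym_funK. Qed.

HB.instance Definition _ :=
  isGroup.Build (sym X) sym_mulA sym_mul1 sym_1mul sym_mulV sym_Vmul.

Lemma symM s t x : (s * t) x = t (s x). Proof. by []. Qed.
Lemma symK s x : s^-1 (s x) = x. Proof. exact: sym_funK. Qed.

End SymGroup.

Record symgroup (X : Type) := SymGroup {
  symset :> sym X -> Prop;
  symset1 : symset 1;
  symsetM : forall s t, symset s -> symset t -> symset (s * t);
  symsetV : forall s, symset s -> symset s^-1 }.

Section SubSym.
Variables (X : Type) (K : symgroup X).

Record elt := Elt { eltval :> sym X; eltP : K eltval }.

Lemma elt_ext (a b : elt) : a =1 b -> a = b.
Proof.
case: a b => [s Ks] [t Kt] /= /sym_ext est; move: Ks; rewrite est => Ks.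
by congr Elt; apply: Prop_irrelevance.
Qed.

HB.instance Definition _ := gen_eqMixin elt.
HB.instance Definition _ := gen_choiceMixin elt.

Definition elt_one := Elt (symset1 K).
Definition elt_opp a := Elt (symsetV (eltP a)).
Definition elt_mul a b := Elt (symsetM (eltP a) (eltP b)).

Fact elt_mulA : associative elt_mul.
Proof. by move=> a b c; apply: elt_ext. Qed.
Fact elt_mul1 : left_id elt_one elt_mul.
Proof. by move=> a; apply: elt_ext. Qed.
Fact elt_1mul : right_id elt_one elt_mul.
Proof. by move=> a; apply: elt_ext. Qed.
Fact elt_mulV : left_inverse elt_one elt_opp elt_mul.
Proof. by move=> a; apply: elt_ext => x /=; rewrite sym_invK. Qed.
Fact elt_Vmul : right_inverse elt_one elt_opp elt_mul.
Proof. by move=> a; apply: elt_ext => x /=; rewrite sym_funK. Qed.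

HB.instance Definition _ :=
  isGroup.Build elt elt_mulA elt_mul1 elt_1mul elt_mulV elt_Vmul.

Definition elt_act (x : X) (a : elt) : X := a x.

Lemma elt_actP : right_action elt_act. Proof. by []. Qed.

End SubSym.

(** * Tame actions *)

Section ActionConditions.
Variables (H : groupType) (X : Type) (act : X -> H -> X).

Definition trivial_pair_stabilizers : Prop :=
  forall g x y, x <> y -> act x g = x -> act y g = y -> g = 1.

Definition fixed_point_free_involutions : Prop :=
  forall g x, g * g = 1 -> act x g = x -> g = 1.

End ActionConditions.

Lemma sval_inj (T : Type) (P : T -> Prop) : injective (@sval T P).
Proof. by move=> [x Px] [y Py] xy; apply: eq_exist. Qed.

(** A choice depending only on the class: related points have equal classes as
    predicates, and the element is chosen from the predicate. *)
Lemma canonical_representative (T : Type) (E : T -> T -> Prop) :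
    (forall x, E x x) -> (forall x y, E x y -> E y x) ->
    (forall x y z, E x y -> E y z -> E x z) ->
  {c : T -> T | (forall x, E x (c x)) & forall x y, E x y -> c x = c y}.
Proof.
move=> Erefl Esym Etrans.
pose pick (P : T -> Prop) (x : T) :=
  if pselect (exists y, P y) is left ex then sval (cid ex) else x.
exists (fun x => pick (E x) x) => [x|x y Exy]; rewrite /pick.
  by case: pselect => [ex|[]]; [case: cid | exists x].
have -> : E y = E x.
  by apply/predeqP => z; split => ?; [apply: Etrans Exy _ |
    apply: Etrans (Esym _ _ Exy) _].
by case: pselect => [ex //|[]]; exists x.
Qed.

(** * The free completion of a family of partial maps *)

Section Completion.
Variables (G : groupType) (X : Type) (act : X -> G -> X).
Hypothesis actP : right_action act.
Hypothesis actS : trivial_pair_stabilizers act.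
Hypothesis actI : fixed_point_free_involutions act.

Let act1 x : act x 1 = x. Proof. exact: (proj1 actP). Qed.
Let actM x g h : act x (g * h) = act (act x g) h.
Proof. exact: (proj2 actP). Qed.

(** The letter f_i is to map D i true k to D i false k, for both values of k;
    the boolean e = false denotes its inverse.  It must also satisfy
    A i true * f_i = f_i * A i false, where these two elements are both trivial
    or both swap the two points at their side. *)
Variables (I : Type) (D : I -> bool -> bool -> X) (A : I -> bool -> G).
Hypothesis D_neq : forall i e k, D i e k <> D i e (~~ k).
Hypothesis A_case : forall i,
  (forall e, A i e = 1) \/ (forall e k, act (D i e k) (A i e) = D i e (~~ k)).

Lemma A_swap i e : A i e <> 1 -> forall k, act (D i e k) (A i e) = D i e (~~ k).
Proof. by case: (A_case i) => [->|]. Qed.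

Lemma A_square i e : A i e * A i e = 1.
Proof.
have [->|/eqP/A_swap sw] := eqVneq (A i e) 1; first by rewrite mulg1.
apply: (actS (@D_neq i e true)); by rewrite actM !sw negbK.
Qed.

Lemma A_eq1 i e : A i e = 1 -> A i (~~ e) = 1.
Proof.
case: (A_case i) => [|sw A1]; first by [].
by have := sw e true; rewrite A1 act1 => /D_neq.
Qed.

(** The node Step q i e g stands for the point obtained from q by the letter
    f_i^e followed by g. *)
Inductive node := Base of X | Step of node & I & bool & G.

Definition nact p h :=
  match p with
  | Base x => Base (act x h)
  | Step q i e g => Step q i e (g * h)
  end.

Lemma nact1 p : nact p 1 = p.
Proof. by case: p => [x|q i e g] /=; rewrite ?act1 ?mulg1. Qed.

Lemma nactM p g h : nact p (g * h) = nact (nact p g) h.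
Proof. by case: p => [x|q i e k] /=; rewrite ?actM ?mulgA. Qed.

(** On a new orbit G acts by translations; on X this is the hypothesis on
    involutions. *)
Lemma nact_free p g : g * g = 1 -> nact p g = p -> g = 1.
Proof.
case: p => [x|q i e h] /= gg []; first exact: actI.
by rewrite -{2}[h]mulg1 => /mulgI.
Qed.

Lemma nactAA p i e : nact (nact p (A i e)) (A i e) = p.
Proof. by rewrite -nactM A_square nact1. Qed.

Fixpoint depth p := if p is Step q _ _ _ then (depth q).+1 else 0.

Lemma depth_nact p g : depth (nact p g) = depth p.
Proof. by case: p. Qed.

(** The image of p under f_i^e when no new point is needed: either the letter
    is defined at p inside X, or p was reached by the opposite letter, up to an
    element that can be moved across it. *)
Definition back i e p : option node :=
  match p with
  | Base x =>
      if `[< x = D i e true >] then Some (Base (D i (~~ e) true))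
      else if `[< x = D i e false >] then Some (Base (D i (~~ e) false))
      else None
  | Step q j d g =>
      if `[< j = i >] && (d == ~~ e) then
        if g == 1 then Some q
        else if g == A i e then Some (nact q (A i (~~ e)))
        else None
      else None
  end.

Lemma back_D i e k : back i e (Base (D i e k)) = Some (Base (D i (~~ e) k)).
Proof.
rewrite /=; case: k; first by case: asboolP.
by case: asboolP => [/esym/D_neq//|_]; case: asboolP.
Qed.

Lemma back_notD i e x : (forall k, x <> D i e k) -> back i e (Base x) = None.
Proof. by move=> xD /=; do 2!case: asboolP => [/xD//|_]. Qed.

(** This is where the relation imposed on f_i agrees with its prescribed values:
    A i e permutes the two points of X at which f_i^e is given just as
    A i (~~ e) permutes their images. *)
Lemma back_nact i e p :
  back i e (nact p (A i e)) = omap (nact^~ (A i (~~ e))) (back i e p).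
Proof.
have [A1|/eqP An1] := eqVneq (A i e) 1.
  rewrite A1 A_eq1 // nact1.
  by case: back => //= q; rewrite nact1.
have sw d k : act (D i d k) (A i d) = D i d (~~ k).
  by case: (A_case i) => [A1|//]; case: An1.
case: p => [x|q j d g].
  have swb k : x = D i e k -> nact (Base x) (A i e) = Base (D i e (~~ k)).
    by move=> ->; rewrite /= sw.
  have [[k xk]|xD] := pselect (exists k, x = D i e k).
    by rewrite (swb k xk) xk !back_D /= sw.
  rewrite (@back_notD i e x) => [|k xk]; last by apply: xD; exists k.
  apply: back_notD => k xk; apply: xD.
  by exists (~~ k); rewrite -[x]act1 -(A_square i e) actM xk sw.
rewrite /=; case: ifP => // _.
have -> : (g * A i e == 1) = (g == A i e).
  apply/eqP/eqP => [h|->]; last exact: A_square.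
  by rewrite -[g]mulg1 -(A_square i e) mulgA h mul1g.
have -> : (g * A i e == A i e) = (g == 1).
  apply/eqP/eqP => [h|->]; last exact: mul1g.
  by apply: (@mulIg _ (A i e)); rewrite h mul1g.
have [->|gn1] := eqVneq g 1.
  by rewrite eq_sym; case: eqP.
by case: eqP => //= _; rewrite nactAA.
Qed.

(** Since f_i^e carries the pair p, p * A i e to a pair of the same kind, only
    one point of each pair may carry a new Step, or points would have two
    names. *)
Lemma rep_spec i e : {r : node -> node |
    forall p, r p = p \/ r p = nact p (A i e) &
    forall p, r (nact p (A i e)) = r p}.
Proof.
have [] := @canonical_representative node
  (fun p q => q = p \/ q = nact p (A i e)).
- by move=> p; left.
- by move=> p q [->|->]; [left|right; rewrite nactAA].
- by move=> p q s [->|->] [->|->]; rewrite ?nactAA; auto.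
move=> r rE rC; exists r => // p; apply/esym/rC; by right.
Qed.

Definition rep i e : node -> node := s2val (rep_spec i e).

Lemma repE i e p : rep i e p = p \/ rep i e p = nact p (A i e).
Proof. exact: (s2valP (rep_spec i e)). Qed.

Lemma rep_nact i e p : rep i e (nact p (A i e)) = rep i e p.
Proof. exact: (s2valP' (rep_spec i e)). Qed.

Definition fwd i e p : node :=
  if back i e p is Some q then q
  else if `[< rep i e p = p >] then Step p i e 1
  else Step (nact p (A i e)) i e (A i (~~ e)).

(** Reduced names: no letter is followed by its cancellation, and every letter
    is applied to the representative of its pair. *)
Fixpoint valid p : Prop :=
  if p is Step q i e _ then [/\ valid q, back i e q = None & rep i e q = q]
  else True.

Lemma valid_nact p g : valid p -> valid (nact p g).
Proof. by case: p. Qed.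

Lemma fwd_D i e k : fwd i e (Base (D i e k)) = Base (D i (~~ e) k).
Proof. by rewrite /fwd back_D. Qed.

(** Without representatives, the relation A i e * f_i^e = f_i^e * A i (~~ e)
    would fail at the points where f_i^e creates new Steps. *)
Lemma fwd_nact i e p : fwd i e (nact p (A i e)) = nact (fwd i e p) (A i (~~ e)).
Proof.
rewrite /fwd back_nact; case: back => //=.
rewrite rep_nact nactAA.
have [A1|/eqP An1] := eqVneq (A i e) 1.
  by rewrite A1 A_eq1 // nact1; case: asboolP => //= _; rewrite mulg1.
have pn : nact p (A i e) <> p by move/(nact_free (A_square i e)).
case: (asboolP (rep i e p = p)) => rp.
  by rewrite rp; case: asboolP => [/esym//|_] /=; rewrite mul1g.
case: (repE i e p) => // ->.
by case: asboolP => //= _; rewrite A_square.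
Qed.

Lemma valid_fwd i e p : valid p -> valid (fwd i e p).
Proof.
move=> vp; rewrite /fwd; case bp: (back i e p) => [q|].
  case: p vp bp => [x|p j d g] /=.
    by move=> _; do !case: ifP => _ //; move=> -[<-].
  move=> [vp _ _]; do !case: ifP => _ //; move=> -[<-] //.
  exact: valid_nact.
case: asboolP => rp //=.
case: (repE i e p) => // rpA; split; first exact: valid_nact.
  by rewrite back_nact bp.
by rewrite rep_nact.
Qed.

(** Validity of p is needed precisely when f_i^e removes the last Step of p:
    the opposite letter must restore that Step instead of going back further. *)
Lemma fwdK i e p : valid p -> fwd i (~~ e) (fwd i e p) = p.
Proof.
move=> vp; rewrite {2}/fwd; case bp: (back i e p) => [q|].
  case: p vp bp => [x|p j d g].
    move=> _ /=; case: asboolP => [->|_]; last case: asboolP => // ->;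
    by move=> -[<-]; rewrite fwd_D negbK.
  move=> [vp bp rp] /=; case: ifP => // /andP[/asboolP ej /eqP ed].
  move: ej ed bp rp => -> -> bp rp.
  have fp : fwd i (~~ e) p = Step p i (~~ e) 1.
    by rewrite /fwd bp; case: asboolP.
  case: eqP => [-> [<-]//|_]; case: eqP => // -> [<-].
  by rewrite fwd_nact fp /= mul1g negbK.
case: asboolP => rp.
  by rewrite /fwd /= negbK !eqxx; case: asboolP.
rewrite /fwd /= negbK eqxx eqxx andbT; case: asboolP => // _.
case: eqP => [/A_eq1|_]; last by rewrite ?eqxx ?negbK nactAA.
by rewrite negbK => A1; case: (repE i e p); rewrite A1 nact1.
Qed.

(** * Closed paths in the completion *)

(** The word (g1, i1, e1) ... (gn, in, en) stands for the product
    g1 * f_i1^e1 * ... * gn * f_in^en. *)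
Definition letter := (G * I * bool)%type.

Definition move p (l : letter) := let: (g, i, e) := l in fwd i e (nact p g).

Definition walk p (w : seq letter) := foldl move p w.

(** The product f_i^e * h * f_j^d is then an element of G. *)
Definition turning (l m : letter) : bool :=
  let: (g, i, e) := l in let: (h, j, d) := m in
  `[< [/\ j = i, d = ~~ e & h = 1 \/ h = A i (~~ e)] >].

Definition straight : rel letter := fun l m => ~~ turning l m.

(** The letter leaves p along a new edge of the forest. *)
Definition climbs p (l : letter) : Prop :=
  let: (g, i, e) := l in
  exists q c, [/\ move p l = Step q i e c, depth q = depth p
                & c = 1 \/ c = A i (~~ e)].

(** The letter is used at one of the points of X where it was prescribed. *)
Definition stays_low p (l : letter) : Prop :=
  let: (g, i, e) := l in exists k, nact p g = Base (D i e k).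

Lemma move_case p l :
  [\/ climbs p l, stays_low p l | depth (move p l) < depth p].
Proof.
case: l => [[g i] e] /=; rewrite -(depth_nact p g) /fwd.
case bp: (back i e _) => [q|]; last first.
  case: asboolP => rp; constructor 1.
    by exists (nact p g), 1; split; rewrite ?depth_nact //; left.
  by exists (nact (nact p g) (A i e)), (A i (~~ e)); split;
    rewrite ?depth_nact //; right.
case: (nact p g) bp => [x|r j d h].
  move=> /=; case: asboolP => [->|_]; first by constructor 2; exists true.
  by case: asboolP => [->|//]; constructor 2; exists false.
by rewrite /=; do !case: ifP => _ //; move=> -[<-]; constructor 3;
  rewrite ?depth_nact.
Qed.

(** In the forest there is a single edge from a new vertex back towards X, the
    one by which it was reached; taking it is a cancellation, so a path without
    cancellations that climbs once climbs for ever. *)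
Lemma climbs_straight p l m : straight l m -> climbs p l -> climbs (move p l) m.
Proof.
case: l m => [[g i] e] [[h j] d] /asboolPn nt [q [c [mE dq cE]]].
rewrite /climbs mE {1}/move /fwd /nact.
have -> : back j d (Step q i e (c * h)) = None.
  rewrite /=; case: ifP => // /andP[/asboolP eij /eqP ed].
  have {ed} dE : d = ~~ e by rewrite ed negbK.
  subst j d.
  have ch1 : c * h <> 1.
    move=> ch1; case: nt; split=> //; case: cE ch1 => -> ch1.
      by left; rewrite mul1g in ch1.
    by right; rewrite -[h]mul1g -(A_square i (~~ e)) -mulgA ch1 mulg1.
  have chA : c * h <> A i (~~ e).
    move=> ch; case: nt; split=> //; case: cE ch => -> ch.
      by right; rewrite mul1g in ch.
    by left; apply: (@mulgI _ (A i (~~ e))); rewrite ch mulg1.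
  by case: eqP => // _; case: eqP.
case: asboolP => rp; [exists (Step q i e (c * h)), 1 |
  exists (nact (Step q i e (c * h)) (A j d)), (A j (~~ d))]; split => //; auto.
Qed.

Lemma climbs_depth p l : climbs p l -> depth (move p l) = (depth p).+1.
Proof. by case: l => [[g i] e] [q [c [-> <- _]]]. Qed.

Lemma climbs_walk p l w : path straight l w -> climbs p l ->
  depth (walk p (l :: w)) = depth p + (size w).+1.
Proof.
elim: w p l => [|m w IH] p l /=.
  by move=> _ /climbs_depth ->; rewrite addn1.
move=> /andP[lm mw] pl; have pm := climbs_straight lm pl.
by rewrite -/(walk (move p l) (m :: w)) IH // climbs_depth // addSnnS.
Qed.

Lemma walk_cat p v w : walk p (v ++ w) = walk (walk p v) w.
Proof. exact: foldl_cat. Qed.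

(** After rotation the climbing letter comes first, and the path would end
    higher than it started. *)
Lemma closed_no_climb p v l w :
    cycle straight (v ++ l :: w) -> walk p (v ++ l :: w) = p ->
  ~ climbs (walk p v) l.
Proof.
rewrite -(rot_cycle (size v)) rot_size_cat /= rcons_path => /andP[st _] pp cl.
have := climbs_walk st cl; rewrite -cat_cons.
have -> : walk (walk p v) ((l :: w) ++ v) = walk p v.
  by rewrite -walk_cat catA walk_cat pp.
by move/eqP; rewrite -[X in X == _]addn0 eqn_add2l.
Qed.

Lemma no_climb_depth p w :
    (forall v l u, w = v ++ l :: u -> ~ climbs (walk p v) l) ->
  depth (walk p w) <= depth p.
Proof.
elim: w p => [//|l w IH] p nc /=.
apply: (@leq_trans (depth (move p l))); last first.
  case: (move_case p l) => [|low|/ltnW//]; first by move/(nc [::]) => /(_ w).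
  case: l {nc} low => [[g i] e] [k] /= pk.
  by rewrite pk fwd_D -(depth_nact p g) pk.
by apply: IH => v m u wE; apply: (nc (l :: v) m u); rewrite wE.
Qed.

(** As no letter climbs, the depth never increases along the path, so on a
    closed path it never decreases either. *)
Lemma closed_stays_low p l w :
  cycle straight (l :: w) -> walk p (l :: w) = p -> stays_low p l.
Proof.
move=> st pp; case: (move_case p l) => // [cl|lt].
  by case: (@closed_no_climb p [::] l w).
have: depth (walk p (l :: w)) <= depth (move p l).
  apply: (@no_climb_depth (move p l) w) => v m u wE.
  rewrite wE in st pp; exact: (@closed_no_climb p (l :: v) m u).
by rewrite pp leqNgt lt.
Qed.

(** The new pairs represent distinct orbits of unordered pairs, other than the
    orbit of the distinguished pair, and a swap of a new pair, if there is one,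
    is the element associated with its letter. *)
Hypothesis D_inequiv : forall i j k m g,
  act (D i false k) g = D j true m ->
  act (D i false (~~ k)) g = D j true (~~ m) -> False.

Hypothesis D_equiv : forall i j k m g,
  act (D i false k) g = D j false m ->
  act (D i false (~~ k)) g = D j false (~~ m) ->
  j = i /\ (g = 1 \/ g = A i false).

Lemma nact_inj g : injective (nact^~ g).
Proof.
by move=> p q /(congr1 (nact^~ g^-1)) /=; rewrite -!nactM mulgV !nact1.
Qed.

Lemma low_pair p q l : p <> q -> stays_low p l -> stays_low q l ->
  let: (g, i, e) := l in exists k,
    nact p g = Base (D i e k) /\ nact q g = Base (D i e (~~ k)).
Proof.
case: l => [[g i] e] pq [k pk] [m qm]; exists k; split=> //.
have negE (a b : bool) : a <> b -> a = ~~ b by case: a b => -[].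
rewrite qm (negE m k) // => mk; apply: pq.
by apply: (@nact_inj g); rewrite /= pk qm mk.
Qed.

(** Consecutive letters l and m that move two points inside X match the pair at
    the end of l with the pair at the start of m.  Without a cancellation, these
    can only lie in the same orbit if both are of the form D i true, that is, if
    l has a negative exponent and m a positive one. *)
Lemma low_turn p q l m : p <> q -> straight l m ->
    stays_low p l -> stays_low q l ->
    stays_low (move p l) m -> stays_low (move q l) m ->
  l.2 = false /\ m.2 = true.
Proof.
case: l m => [[g i] e] [[h j] d] pq /asboolPn nt pl ql.
have [k [pk qk]] := low_pair pq pl ql.
rewrite /move pk qk !fwd_D => pm qm.
have kn : Base (D i (~~ e) k) <> Base (D i (~~ e) (~~ k)) by case=> /D_neq.
have [n [[pn] [qn]]] := low_pair kn pm qm.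
have D_inequivC i1 j1 k1 m1 g1 : act (D j1 true m1) g1 = D i1 false k1 ->
    act (D j1 true (~~ m1)) g1 = D i1 false (~~ k1) -> False.
  move=> e1 e2; apply: (@D_inequiv i1 j1 k1 m1 g1^-1).
    by rewrite -e1 -actM mulgV act1.
  by rewrite -e2 -actM mulgV act1.
case: e d nt {kn pm qm pl ql pk qk} pn qn => -[] //= nt pn qn.
- by case: (D_inequiv pn qn).
- by case: (D_equiv pn qn) => ji hE; case: nt; split.
- by case: (D_inequivC _ _ _ _ _ pn qn).
Qed.

(** Two successive uses of low_turn are contradictory: the first says that the
    second letter has a positive exponent, the other that it has a negative
    one.  In a word of length 1 the letter is its own successor. *)
Lemma straight_fixes_one w p q : w <> [::] -> cycle straight w -> p <> q ->
  walk p w = p -> walk q w = q -> False.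
Proof.
case: w => // l w _ st pq pp qq.
have rotc x s : cycle straight (x :: s) -> cycle straight (rcons s x).
  by rewrite -(rot_cycle 1) rot1_cons.
have rotw x s a : walk a (x :: s) = a -> walk (move a x) (rcons s x) = move a x.
  by move=> aE; rewrite -cats1 walk_cat [walk (move a x) s]aE.
have neq x s a b : a <> b -> walk a (x :: s) = a -> walk b (x :: s) = b ->
    move a x <> move b x.
  by move=> ab aE bE mE; apply: ab; rewrite -aE -bE /= mE.
have turn x s : cycle straight (x :: s) ->
    forall a b, a <> b -> walk a (x :: s) = a -> walk b (x :: s) = b ->
  x.2 = false /\ (head x (rcons s x)).2 = true.
  move=> stx a b ab aE bE.
  have := rotc _ _ stx; have := rotw _ _ _ aE; have := rotw _ _ _ bE.
  have: straight x (head x (rcons s x)).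
    by move: stx; case: s {aE bE} => [|y s] /= /andP[].
  case sE: (rcons s x) => [|y t] /=; first by case: s sE {aE bE stx}.
  move=> xy yb ya yt; apply: (low_turn ab xy).
  - exact: closed_stays_low stx aE.
  - exact: closed_stays_low stx bE.
  - exact: closed_stays_low yt ya.
  - exact: closed_stays_low yt yb.
have [_] := turn _ _ st _ _ pq pp qq.
have := rotw _ _ _ pp; have := rotw _ _ _ qq; have := rotc _ _ st.
case sE: (rcons w l) => [|m u] /=; first by case: w sE {pp qq st}.
move=> stm qm pm; have [->//] := turn _ _ stm _ _ (neq _ _ _ _ pq pp qq) pm qm.
Qed.

(** * The enlarged permutation group *)

Definition vnode := {p : node | valid p}.

Definition vnact g (p : vnode) : vnode := exist _ _ (valid_nact g (svalP p)).
Definition vfwd i e (p : vnode) : vnode := exist _ _ (valid_fwd i e (svalP p)).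

Fact vnactK g : cancel (vnact g) (vnact g^-1).
Proof. by move=> p; apply: sval_inj; rewrite /= -nactM mulgV nact1. Qed.
Fact vnactVK g : cancel (vnact g^-1) (vnact g).
Proof. by move=> p; apply: sval_inj; rewrite /= -nactM mulVg nact1. Qed.
Fact vfwdK i e : cancel (vfwd i e) (vfwd i (~~ e)).
Proof. by move=> p; apply: sval_inj; rewrite /= fwdK //; apply: svalP. Qed.
Fact vfwdVK i e : cancel (vfwd i (~~ e)) (vfwd i e).
Proof. by move=> p; rewrite -{1}[e]negbK vfwdK. Qed.

Definition group_sym g : sym vnode := MakeSym (vnactK g) (vnactVK g).
Definition edge_sym i e : sym vnode := MakeSym (vfwdK i e) (vfwdVK i e).

Lemma group_symM g h : group_sym (g * h) = group_sym g * group_sym h.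
Proof. by apply: sym_ext => p; apply: sval_inj; rewrite /= nactM. Qed.

Lemma group_sym1 : group_sym 1 = 1.
Proof. by apply: sym_ext => p; apply: sval_inj; rewrite /= nact1. Qed.

Lemma group_symV g : group_sym g^-1 = (group_sym g)^-1.
Proof.
by apply: (@mulgI _ (group_sym g)); rewrite -group_symM !mulgV group_sym1.
Qed.

Lemma edge_symV i e : (edge_sym i e)^-1 = edge_sym i (~~ e).
Proof. by apply: sym_ext. Qed.

Lemma edge_symVK i e : edge_sym i e * edge_sym i (~~ e) = 1.
Proof. by rewrite -edge_symV mulgV. Qed.

Lemma group_sym_edge_sym i e :
  group_sym (A i e) * edge_sym i e = edge_sym i e * group_sym (A i (~~ e)).
Proof. by apply: sym_ext => p; apply: sval_inj; rewrite /= fwd_nact. Qed.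

(** Right multiplication by generators suffices, as their inverses are again
    generators. *)
Inductive generated : sym vnode -> Prop :=
| generated1 : generated 1
| generated_group_sym s g : generated s -> generated (s * group_sym g)
| generated_edge_sym s i e : generated s -> generated (s * edge_sym i e).

Lemma generatedM s t : generated s -> generated t -> generated (s * t).
Proof.
move=> gs; elim=> [|{}t g _ IH|{}t i e _ IH]; rewrite ?mulg1 ?mulgA //.
  exact: generated_group_sym.
exact: generated_edge_sym.
Qed.

Lemma group_sym_generated g : generated (group_sym g).
Proof.
by rewrite -[group_sym g]mul1g; apply: generated_group_sym generated1.
Qed.

Lemma edge_sym_generated i e : generated (edge_sym i e).
Proof.
by rewrite -[edge_sym i e]mul1g; apply: generated_edge_sym generated1.
Qed.

Lemma generatedV s : generated s -> generated s^-1.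
Proof.
elim=> [|{}s g _ IH|{}s i e _ IH]; first by rewrite invg1; apply: generated1.
  rewrite invgM -group_symV.
  by apply: generatedM IH; apply: group_sym_generated.
by rewrite invgM edge_symV; apply: generatedM IH; apply: edge_sym_generated.
Qed.

Definition completion_group : symgroup vnode :=
  SymGroup generated1 generatedM generatedV.

Definition base x : vnode := exist valid (Base x) Logic.I.

Fixpoint word_sym (w : seq letter) : sym vnode :=
  if w is (g, i, e) :: u then group_sym g * edge_sym i e * word_sym u else 1.

Lemma word_symE w p : sval (word_sym w p) = walk (sval p) w.
Proof. by elim: w p => [|[[g i] e] w IH] p //=; rewrite IH. Qed.

Lemma word_sym_cat v w : word_sym (v ++ w) = word_sym v * word_sym w.
Proof.
by elim: v => [|[[g i] e] v IH] /=; rewrite ?mul1g // IH !mulgA.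
Qed.

Lemma generatedP s : generated s -> exists w g, s = word_sym w * group_sym g.
Proof.
elim=> [|{}s h _ [w [g ->]]|{}s i e _ [w [g ->]]].
- by exists [::], 1; rewrite group_sym1 mulg1.
- by exists w, (g * h); rewrite group_symM mulgA.
exists (w ++ [:: (g, i, e)]), 1.
by rewrite word_sym_cat /= group_sym1 !mulg1 !mulgA.
Qed.

Definition tame (s : sym vnode) : Prop :=
  (forall p q, p <> q -> s p = p -> s q = q -> s = 1) /\
  (forall p, s * s = 1 -> s p = p -> s = 1).

(** Tameness is conjugation invariant; this is what allows words to be reduced
    cyclically. *)
Lemma tame_conj s t : tame (s ^ t) -> tame s.
Proof.
have fixJ p : s p = p -> (s ^ t) (t p) = t p.
  by move=> sp; rewrite conjgE !symM symK sp.
have J1 : s ^ t = 1 -> s = 1.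
  by move=> st; rewrite -[s](conjgK t) st conj1g.
move=> [two inv]; split=> [p q pq /fixJ sp /fixJ sq|p ss /fixJ sp]; apply: J1.
  by apply: two sp sq => tpq; apply: pq; rewrite -(symK t p) tpq symK.
by apply: inv sp; rewrite -conjMg ss conj1g.
Qed.

Variables x0 y0 : X.
Hypothesis x0y0 : x0 <> y0.

Lemma tame_group_sym g : tame (group_sym g).
Proof.
split=> [p q pq|p gg] /(congr1 sval) /=.
  case: p q pq => [p vp] [q vq] pq /= gp /(congr1 sval) /= gq.
  have {}pq : p <> q by move=> pq'; apply: pq; apply: sval_inj.
  suff -> : g = 1 by rewrite group_sym1.
  case: p q pq gp gq {vp vq} => [x|p i e h] [y|q j d k] pq /=; last 3 first.
  - by move=> _ [] /(canRL (mulKg _)); rewrite mulVg.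
  - by move=> [] /(canRL (mulKg _)); rewrite mulVg.
  - by move=> [] /(canRL (mulKg _)); rewrite mulVg.
  by move=> [gx] [gy]; apply: (actS _ gx gy) => xy; apply: pq; rewrite xy.
move=> gp; suff -> : g = 1 by rewrite group_sym1.
apply: nact_free gp; move: gg; rewrite -group_symM => gg.
have fix_base x : act x (g * g) = x.
  by have := congr1 (fun s : sym vnode => sval (s (base x))) gg; case.
exact: (actS x0y0).
Qed.

(** The second condition holds vacuously: if the square of the word were
    trivial, then the doubled word, which is still cyclically reduced, would
    fix more than one point. *)
Lemma tame_straight w : w <> [::] -> cycle straight w -> tame (word_sym w).
Proof.
have fixw u p : word_sym u p = p -> walk (sval p) u = sval p.
  by rewrite -word_symE => ->.
move=> wn st; split=> [p q pq|p ww _].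
  move=> /fixw wp /fixw wq; case: (straight_fixes_one wn st _ wp wq).
  by move=> /sval_inj.
case: (@straight_fixes_one (w ++ w) (Base x0) (Base y0)).
- by case: w wn {st ww}.
- case: w st {wn ww} => // l w; rewrite /= -cat_rcons rcons_cat cat_path => st.
  by rewrite st last_rcons.
- by case.
- by rewrite (fixw (w ++ w) (base x0)) // word_sym_cat ww.
- by rewrite (fixw (w ++ w) (base y0)) // word_sym_cat ww.
Qed.

Lemma word_sym_rot n w : word_sym (rot n w) = word_sym w ^ word_sym (take n w).
Proof.
have := word_sym_cat (take n w) (drop n w); rewrite cat_take_drop => ->.
by rewrite /rot word_sym_cat conjgE !mulgA mulVg mul1g.
Qed.

Lemma not_path (x : letter) s : ~~ path straight x s ->
  exists v l m u, x :: s = v ++ [:: l, m & u] /\ turning l m.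
Proof.
elim: s x => //= y s IH x; rewrite negb_and negbK => /orP[xy|/IH].
  by exists [::], x, y, s.
by move=> [v [l [m [u [-> lm]]]]]; exists (x :: v), l, m, u.
Qed.

Lemma not_cycle w : ~~ cycle straight w ->
  exists n l m u, rot n w = [:: l, m & u] /\ turning l m.
Proof.
case: w => // x s /not_path[v [l [m [u []]]]]; rewrite -rcons_cons.
case/lastP: u => [|u z]; last first.
  rewrite -!rcons_cons -rcons_cat => /rcons_inj[wE _] lm.
  by exists (size v), l, m, (u ++ v); rewrite wE rot_size_cat.
(* The cancellation is between the last letter and the first one. *)
rewrite -[v ++ _]cat_rcons cats1 => /rcons_inj[wE <-] lx.
case: v wE => [|y v] /= [xl sE].
  by move: lx; rewrite -xl; case: (x) => [[g i] []] /asboolP[].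
exists (size v).+1, l, x, v; split=> //; rewrite sE.
by rewrite -rcons_cons -cats1 -[(size v).+1]/(size (x :: v)) rot_size_cat.
Qed.

Lemma turning_cancel l m u : turning l m ->
  exists h, word_sym [:: l, m & u] = group_sym h * word_sym u.
Proof.
case: l m => [[g i] e] [[h j] d] /asboolP[-> -> hE] /=.
case: hE => ->.
  exists g; rewrite group_sym1 mul1g !mulgA -(mulgA (group_sym g)).
  by rewrite edge_symVK mulg1.
exists (g * A i e).
rewrite !mulgA -(mulgA (group_sym g) (edge_sym i e)) -group_sym_edge_sym !mulgA.
by rewrite -(mulgA _ (edge_sym i e)) edge_symVK mulg1 group_symM.
Qed.

(** Induction on the length: a word that is not cyclically reduced can be
    rotated so that a cancellation comes first, which shortens it by two
    letters. *)
Lemma tame_word_sym w : tame (word_sym w).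
Proof.
have [n] := ubnP (size w); elim: n w => // n IH w; rewrite ltnS => wn.
case wE: w => [|l0 w0]; first by rewrite /= -group_sym1; apply: tame_group_sym.
rewrite -wE; have w_neq : w <> [::] by rewrite wE.
have [/(tame_straight w_neq)//|/not_cycle] := boolP (cycle straight w).
move=> [k [l [m [u [rE lm]]]]].
apply: (@tame_conj _ (word_sym (take k w))); rewrite -word_sym_rot rE.
have {rE}: (size u).+2 <= n.
  by rewrite -[_.+2]/(size [:: l, m & u]) -rE size_rot.
have [h ->] := turning_cancel u lm.
case: u => [|[[g i] e] u] un; first by rewrite mulg1; apply: tame_group_sym.
have -> :
    group_sym h * word_sym ((g, i, e) :: u) = word_sym ((h * g, i, e) :: u).
  by rewrite /= group_symM !mulgA.
by apply: IH; apply: ltnW.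
Qed.

Lemma tame_generated s : generated s -> tame s.
Proof.
move=> /generatedP[w [g ->]].
apply: (@tame_conj _ (group_sym g)^-1); rewrite conjgE invgK mulgK.
case: w => [|[[h i] e] w] /=; first by rewrite mulg1; apply: tame_group_sym.
by have := tame_word_sym ((g * h, i, e) :: w); rewrite /= group_symM !mulgA.
Qed.

End Completion.

(** * One step of the construction *)

(** Thanks to the swap of the distinguished pair, orbits of unordered pairs can
    be used: a pair that is equivalent to it in one order is so in both. *)
Record stage := Stage {
  sgroup : groupType;
  spoint :> Type;
  sact : spoint -> sgroup -> spoint;
  sactP : right_action sact;
  sactS : trivial_pair_stabilizers sact;
  sactI : fixed_point_free_involutions sact;
  spair : bool -> spoint;
  spair_neq : spair true <> spair false;
  spair_swap : exists s, forall k, sact (spair k) s = spair (~~ k) }.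

(** As T is tame, h is determined by its action on the image of j; therefore it
    automatically depends multiplicatively on g. *)
Definition extends (S T : stage) (j : S -> T) : Prop :=
  injective j /\ forall g, exists h, forall x, j (sact x g) = sact (j x) h.

Definition reaches_pairs (S T : stage) (j : S -> T) : Prop :=
  forall x y, x <> y ->
    exists g, sact (spair T true) g = j x /\ sact (spair T false) g = j y.

Section Step.
Variable S : stage.
Let G := sgroup S.
Let X := spoint S.
Local Notation act := (@sact S).

Let act1 x : act x 1 = x. Proof. exact: (proj1 (sactP S)). Qed.
Let actM x g h : act x (g * h) = act (act x g) h.
Proof. exact: (proj2 (sactP S)). Qed.

Definition entry (q : X * X) (k : bool) : X := if k then q.1 else q.2.

(** Orbits of unordered pairs: b tells whether the two entries are exchanged. *)
Definition same_orbit (p q : X * X) : Prop :=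
  exists g b, forall k, act (entry p k) g = entry q (k (+) b).

Lemma same_orbit_refl p : same_orbit p p.
Proof. by exists 1, false => k; rewrite act1 addbF. Qed.

Lemma same_orbit_sym p q : same_orbit p q -> same_orbit q p.
Proof.
move=> [g [b pq]]; exists g^-1, b => k.
have := pq (k (+) b); rewrite -addbA addbb addbF => <-.
by rewrite -actM mulgV act1.
Qed.

Lemma same_orbit_trans p q r :
  same_orbit p q -> same_orbit q r -> same_orbit p r.
Proof.
move=> [g [b pq]] [h [d qr]]; exists (g * h), (b (+) d) => k.
by rewrite actM pq qr addbA.
Qed.

Lemma same_orbitI p q k m g : act (entry p k) g = entry q m ->
  act (entry p (~~ k)) g = entry q (~~ m) -> same_orbit p q.
Proof.
by move=> pq pq'; exists g, (k (+) m) => -[]; case: k m pq pq' => -[].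
Qed.

Lemma entry_neq q k : q.1 <> q.2 -> entry q k <> entry q (~~ k).
Proof. by case: k => //= q12 /esym. Qed.

Let base_pair := (spair S true, spair S false).

Lemma entry_base k : entry base_pair k = spair S k.
Proof. by case: k. Qed.

Let crep_spec := canonical_representative same_orbit_refl same_orbit_sym
  same_orbit_trans.
Let crep := s2val crep_spec.
Let crepE q : same_orbit q (crep q) := s2valP crep_spec q.
Let crep_eq p q : same_orbit p q -> crep p = crep q := s2valP' crep_spec p q.

Definition new_orbit := {q : X * X |
  [/\ q.1 <> q.2, crep q = q & ~ same_orbit q base_pair]}.

Definition ends (i : new_orbit) (e : bool) : bool -> X :=
  entry (if e then base_pair else sval i).

Lemma ends_neq i e k : ends i e k <> ends i e (~~ k).
Proof.
apply: entry_neq; case: e; first exact: spair_neq.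
by case: (svalP i).
Qed.

(** When an element swaps the new pair, the letter conjugates the swap of the
    distinguished pair to it; otherwise the letter is free, and both associated
    elements are 1. *)
Lemma swap_exists (i : new_orbit) : exists a : bool -> G,
  (forall g, (forall k, act (ends i false k) g = ends i false (~~ k)) ->
     g = a false) /\
  ((forall e, a e = 1) \/
   (forall e k, act (ends i e k) (a e) = ends i e (~~ k))).
Proof.
have [[s sP]|no_swap] := pselect
    (exists s, forall k, act (ends i false k) s = ends i false (~~ k));
  last first.
  exists (fun=> 1); split; last by left.
  by move=> g gP; case: no_swap; exists g.
have [t tP] := spair_swap S.
exists (fun e => if e then t else s); split=> [g gP|].
  apply: (@mulIg _ s^-1); rewrite mulgV.
  by apply: (sactS (@ends_neq i false true));
    rewrite actM gP -sP -actM mulgV act1.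
right=> -[] k; last exact: sP.
by rewrite /ends !entry_base.
Qed.

Let A_spec := choice swap_exists.
Definition ends_swap : new_orbit -> bool -> G := projT1 A_spec.

Lemma ends_swapP i : (forall e, ends_swap i e = 1) \/
  (forall e k, act (ends i e k) (ends_swap i e) = ends i e (~~ k)).
Proof. by case: (projT2 A_spec i). Qed.

Lemma ends_swap_uniq i g :
  (forall k, act (ends i false k) g = ends i false (~~ k)) ->
  g = ends_swap i false.
Proof. by case: (projT2 A_spec i) => + _; apply. Qed.

Lemma ends_inequiv i j k m g : act (ends i false k) g = ends j true m ->
  act (ends i false (~~ k)) g = ends j true (~~ m) -> False.
Proof.
by move=> e1 e2; case: (svalP i) => _ _; apply; apply: same_orbitI e1 e2.
Qed.

Lemma ends_equiv i j k m g : act (ends i false k) g = ends j false m ->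
  act (ends i false (~~ k)) g = ends j false (~~ m) ->
  j = i /\ (g = 1 \/ g = ends_swap i false).
Proof.
move=> e1 e2; have ji : j = i.
  apply: sval_inj; have /crep_eq := same_orbitI e1 e2.
  by case: (svalP i) (svalP j) => [_ -> _] [_ -> _].
split=> //; rewrite {}ji in e1 e2.
have [km|km] := eqVneq k m; [left|right].
  by apply: (sactS (@ends_neq i false k)); rewrite ?e1 ?e2 km.
have {km} mE : m = ~~ k by case: k m km {e1 e2} => -[].
by apply: ends_swap_uniq => -[]; move: e1 e2; rewrite mE; case: (k).
Qed.

Let node_type := vnode (sactP S) (@sactS S) ends_neq ends_swapP.
Let group := completion_group (sactP S) (@sactS S) (@sactI S) ends_neq
  ends_swapP.
Let inc : S -> node_type := base (sactP S) (@sactS S) ends_neq ends_swapP.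
Let old g : elt group :=
  Elt (group_sym_generated (sactP S) (@sactS S) (@sactI S) ends_neq
         ends_swapP g : group _).
Let new i : elt group :=
  Elt (edge_sym_generated (sactP S) (@sactS S) (@sactI S) ends_neq
         ends_swapP i true : group _).

Let inc_inj : injective inc.
Proof. by move=> x y []. Qed.

Let old_inc g x : elt_act (inc x) (old g) = inc (act x g).
Proof. exact: sval_inj. Qed.

Let new_inc i k :
  elt_act (inc (spair S k)) (new i) = inc (entry (sval i) k).
Proof.
apply: sval_inj => /=; rewrite -entry_base.
exact: (@fwd_D _ _ _ (sactP S) (@sactS S) _ _ _ ends_neq ends_swapP i true k).
Qed.

Let group_tame (a : elt group) : tame (a : sym node_type).
Proof.
exact: (tame_generated ends_inequiv ends_equiv (@spair_neq S)) (eltP a).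
Qed.

Let group_trivial_pair_stabilizers :
  trivial_pair_stabilizers (@elt_act _ group).
Proof.
move=> a p q pq ap aq; apply: elt_ext => r.
by have [two _] := group_tame a; rewrite (two p q pq ap aq).
Qed.

Let group_fixed_point_free : fixed_point_free_involutions (@elt_act _ group).
Proof.
move=> a p aa ap; apply: elt_ext => r.
have [_ inv] := group_tame a; rewrite (inv p) //.
by have /(congr1 (@eltval _ _)) := aa.
Qed.

Let inc_pair_neq : inc (spair S true) <> inc (spair S false).
Proof. by move/inc_inj/spair_neq. Qed.

Let inc_pair_swap : exists s, forall k,
  @elt_act _ group (inc (spair S k)) s = inc (spair S (~~ k)).
Proof.
by have [s sP] := spair_swap S; exists (old s) => k; rewrite old_inc sP.
Qed.

Definition next_stage : stage :=
  Stage (@elt_actP _ group) group_trivial_pair_stabilizers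
    group_fixed_point_free inc_pair_neq inc_pair_swap.

Lemma extension_step : exists (T : stage) (j : S -> T),
  extends j /\ reaches_pairs j.
Proof.
exists next_stage, inc; split.
  by split; [exact: inc_inj | move=> g; exists (old g) => x; rewrite -old_inc].
move=> x y xy; pose q := (x, y).
suff [a [b aP]] : exists (a : elt group) b, forall k,
    elt_act (inc (spair S k)) a = inc (entry q (k (+) b)).
  (* If the entries come out exchanged, the distinguished pair is swapped
     beforehand. *)
  case: b aP => aP; last by exists a; split; rewrite /= aP.
  have [s sP] := spair_swap S; exists (old s * a).
  by split; rewrite /= [LHS](proj2 (elt_actP _)) old_inc sP aP.
have [[g [b qP]]|nq] := pselect (same_orbit base_pair q).
  by exists (old g), b => k; rewrite old_inc -qP entry_base.
have cP : [/\ (crep q).1 <> (crep q).2, crep (crep q) = crep q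
             & ~ same_orbit (crep q) base_pair].
  split; last 2 first.
  - by rewrite -(crep_eq (crepE q)).
  - by move=> /(same_orbit_trans (crepE q))/same_orbit_sym.
  have [g [b cqP]] := same_orbit_sym (crepE q) => cc.
  have := cqP true; rewrite /= cc -[(crep q).2]/(entry _ false) cqP.
  by case: b {cqP} => /= yx; apply: xy.
have [g [b cqP]] := same_orbit_sym (crepE q).
exists (new (exist _ _ cP) * old g), b => k.
by rewrite [LHS](proj2 (elt_actP _)) new_inc old_inc /= cqP.
Qed.

End Step.

(** * Limits of towers *)

(** Threads of a tower starting at an arbitrary level.  Shifting the tower in
    the induction avoids any transport along equalities of levels. *)
Lemma coherent_sequence (X : nat -> Type) (j : forall n, X n -> X n.+1)
    (d : forall n, X n) n (x : X n) :
  exists s : forall m, X m, s n = x /\ forall m, n <= m -> s m.+1 = j m (s m).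
Proof.
elim: n X j d x => [|n IH] X j d x.
  by exists (nat_rect X x j).
have [s [sn sj]] := IH (X \o succn) (fun m => j m.+1) (fun m => d m.+1) x.
exists (fun m => if m is m'.+1 then s m' else d 0); split=> //.
by case=> // m; rewrite ltnS; apply: sj.
Qed.

Section Colimit.
Variables (X : nat -> Type) (j : forall n, X n -> X n.+1).
Hypothesis j_inj : forall n, injective (@j n).
Variable d : forall n, X n.

(** The points of the colimit are germs at infinity of coherent sequences. *)
Lemma colimit_exists : exists (Y : Type) (iota : forall n, X n -> Y),
  [/\ forall n, injective (@iota n),
      forall n x, iota n.+1 (j x) = iota n x
    & forall y, exists n x, y = iota n x].
Proof.
pose seqs := forall m, X m.
pose push (n : nat) (x : X n) : seqs := sval (cid (coherent_sequence j d x)).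
have push_n n (x : X n) : push n x n = x.
  exact: (proj1 (svalP (cid (coherent_sequence j d x)))).
have push_j n (x : X n) m : n <= m -> push n x m.+1 = j (push n x m).
  exact: (proj2 (svalP (cid (coherent_sequence j d x))) m).
pose germ (s : seqs) : seqs -> Prop :=
  fun t => exists n, forall m, n <= m -> s m = t m.
have germP s t : (exists n, forall m, n <= m -> s m = t m) -> germ s = germ t.
  move=> [n st]; apply/predeqP => u; split=> -[k su]; exists (maxn n k) => m;
    rewrite geq_max => /andP[nm km]; by rewrite ?st ?su // -?st ?su.
pose Y := {P : seqs -> Prop | exists n x, P = germ (push n x)}.
have germY n (x : X n) : exists n' x', germ (push n x) = germ (push n' x').
  by exists n, x.
exists Y, (fun n x => exist _ (germ (push n x)) (germY n x)); split.
- move=> n x x' /(congr1 sval) /= gE.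
  have [k kP] : germ (push n x) (push n x') by rewrite gE; exists 0.
  have: push n x (n + k) = push n x' (n + k) by apply: kP; apply: leq_addl.
  elim: k {kP} => [|k IH]; first by rewrite addn0 !push_n.
  by rewrite addnS !push_j ?leq_addr // => /j_inj/IH.
- move=> n x; apply: sval_inj; apply: germP; exists n.+1.
  elim=> // m IH; rewrite ltnS leq_eqVlt => /orP[/eqP <-|nm].
    by rewrite push_n push_j // push_n.
  by rewrite (push_j n.+1) // (push_j n) ?(ltnW nm) // IH.
- case=> P [n [x PE]]; exists n, x; exact: sval_inj.
Qed.

Variables (Y : Type) (iota : forall n, X n -> Y).
Hypothesis iota_inj : forall n, injective (@iota n).
Hypothesis iota_j : forall n (x : X n), iota (j x) = iota x.
Hypothesis iota_surj : forall y, exists n x, y = @iota n x.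

Lemma iota_eventually y : exists n, forall m, n <= m -> exists x, y = @iota m x.
Proof.
have [n [x ->]] := iota_surj y; exists n => m nm.
rewrite -(subnKC nm); elim: (m - n) => [|k [z ->]].
  by rewrite addn0; exists x.
by rewrite addnS; exists (j z); rewrite iota_j.
Qed.

(** The value at y is computed at any level where y is present; two such levels
    are compared at a common higher one. *)
Lemma colimit_map (u : forall m, X m -> X m) n :
    (forall m x, n <= m -> u m.+1 (j x) = j (u m x)) ->
  exists U : Y -> Y, forall m x, n <= m -> U (@iota m x) = iota (u m x).
Proof.
move=> uj.
have up m k x : n <= m -> exists z : X (m + k),
    iota z = iota x /\ iota (u _ z) = iota (u m x).
  move=> nm; elim: k => [|k [z [z1 z2]]]; first by rewrite addn0; exists x.
  rewrite addnS; exists (j z).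
  by rewrite uj ?iota_j // (leq_trans nm) // leq_addr.
suff /choice[U UP] : forall y, exists z,
    forall m (x : X m), n <= m -> y = iota x -> z = iota (u m x).
  by exists U => m x nm; apply: UP.
move=> y; have [n0 /(_ (maxn n n0) (leq_maxr _ _))[x0 yx0]] :=
  iota_eventually y.
exists (iota (u _ x0)) => m x nm; rewrite {}yx0 => xE.
have [z [z1 <-]] := up _ m x0 (leq_maxl n n0).
have [z' [z'1 <-]] := up _ (maxn n n0) x nm.
move: z z1 z' z'1; rewrite (addnC m) => z z1 z' z'1.
by congr iota; congr u; apply: iota_inj; rewrite z1 z'1.
Qed.

Lemma iota_common n y z w : exists m, n <= m /\
  exists x1 x2 x3, [/\ y = @iota m x1, z = @iota m x2 & w = @iota m x3].
Proof.
have [k1 y1] := iota_eventually y; have [k2 y2] := iota_eventually z.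
have [k3 y3] := iota_eventually w.
pose m := maxn (maxn n k1) (maxn k2 k3); exists m.
have [mn m1 m2 m3] : [/\ n <= m, k1 <= m, k2 <= m & k3 <= m].
  by rewrite /m !leq_max !leqnn ?orbT.
split=> //; have [x1 yE] := y1 m m1; have [x2 zE] := y2 m m2.
by have [x3 wE] := y3 m m3; exists x1, x2, x3.
Qed.

End Colimit.

Section Tower.
Variables (T : nat -> stage) (j : forall n, T n -> T n.+1).
Hypothesis j_extends : forall n, extends (@j n).
Hypothesis j_reaches : forall n, reaches_pairs (@j n).
Variables (Y : Type) (iota : forall n, T n -> Y).
Hypothesis iota_inj : forall n, injective (@iota n).
Hypothesis iota_j : forall n x, iota (j x) = @iota n x.
Hypothesis iota_surj : forall y, exists n x, y = @iota n x.

Let sact1 n (x : T n) : sact x 1 = x. Proof. exact: (proj1 (sactP _)). Qed.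
Let sactM n (x : T n) g h : sact x (g * h) = sact (sact x g) h.
Proof. exact: (proj2 (sactP _)). Qed.

(** The element g depends on the level m; the elements for different m are
    automatically compatible, since they induce the same permutation. *)
Definition induced (s : sym Y) : Prop := exists n, forall m, n <= m ->
  exists g, forall x, s (@iota m x) = iota (sact x g).

Lemma induced1 : induced 1.
Proof. by exists 0 => m _; exists 1 => x; rewrite sact1. Qed.

Lemma inducedM s t : induced s -> induced t -> induced (s * t).
Proof.
move=> [n sn] [k tk]; exists (maxn n k) => m; rewrite geq_max => /andP[nm km].
have [g gP] := sn m nm; have [h hP] := tk m km.
by exists (g * h) => x; rewrite symM gP hP sactM.
Qed.

Lemma inducedV s : induced s -> induced s^-1.
Proof.
move=> [n sn]; exists n => m /sn[g gP]; exists g^-1 => x.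
by rewrite -{1}[x]sact1 -(mulVg g) sactM -gP symK.
Qed.

Definition limit_group : symgroup Y := SymGroup induced1 inducedM inducedV.

Notation limit_act := (@elt_act Y limit_group).

(** A coherent sequence of elements through g acts level by level, and so does
    the sequence of inverses. *)
Lemma induce n (g : sgroup (T n)) :
  exists a : elt limit_group, forall x, a (@iota n x) = iota (sact x g).
Proof.
have [eps epsP] : {eps : forall m, sgroup (T m) -> sgroup (T m.+1) |
    forall m g x, j (@sact (T m) x g) = sact (j x) (eps m g)}.
  exists (fun m => projT1 (choice (proj2 (@j_extends m)))) => m h.
  exact: projT2 (choice (proj2 (@j_extends m))) h.
have [h [hn hj]] := coherent_sequence eps (fun m => 1) g.
have epsV m k x : j (@sact (T m) x k^-1) = sact (j x) (eps m k)^-1.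
  rewrite -[LHS]sact1 -(mulgV (eps m k)) sactM; congr sact.
  by rewrite -epsP -sactM mulVg sact1.
have [U UP] := colimit_map iota_inj iota_j iota_surj
  (u := fun m x => sact x (h m)) (n := n) (fun m x nm =>
     etrans (congr1 _ (hj m nm)) (esym (epsP m (h m) x))).
have [V VP] := colimit_map iota_inj iota_j iota_surj
  (u := fun m x => sact x (h m)^-1) (n := n) (fun m x nm =>
     etrans (congr1 (fun k => sact _ k^-1) (hj m nm)) (esym (epsV m (h m) x))).
have UV : cancel U V.
  move=> y; have [k /(_ (maxn n k) (leq_maxr _ _))[x ->]] :=
    iota_eventually iota_j iota_surj y.
  by rewrite UP ?leq_maxl // VP ?leq_maxl // -sactM mulgV sact1.
have VU : cancel V U.
  move=> y; have [k /(_ (maxn n k) (leq_maxr _ _))[x ->]] :=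
    iota_eventually iota_j iota_surj y.
  by rewrite VP ?leq_maxl // UP ?leq_maxl // -sactM mulVg sact1.
have sL : limit_group (MakeSym UV VU).
  by exists n => m nm; exists (h m) => x /=; apply: UP.
by exists (Elt sL) => x /=; rewrite UP // hn.
Qed.

Lemma limit_trivial_pair_stabilizers : trivial_pair_stabilizers limit_act.
Proof.
move=> a y z yz ay az; apply: elt_ext => w; have [n nP] := eltP a.
have [m [nm [x [x' [x'' [yx zx' ->]]]]]] :=
  iota_common iota_j iota_surj n y z w.
have [g gP] := nP m nm; rewrite [LHS]gP; congr iota.
suff -> : g = 1 by rewrite sact1.
apply: (@sactS _ g x x').
- by move=> xx'; apply: yz; rewrite yx zx' xx'.
- by apply: iota_inj; rewrite -gP -yx.
- by apply: iota_inj; rewrite -gP -zx'.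
Qed.

(** Elements of the limit group that agree at the two points of the
    distinguished pair are equal, so the relation between g and the element it
    induces is an injective morphism. *)
Lemma stage_embeds n : exists f : sgroup (T n) -> elt limit_group,
  {morph f : g h / g * h} /\ injective f.
Proof.
have [f fP] := choice (@induce n).
have ext (a b : elt limit_group) :
    (forall x, a (@iota n x) = b (@iota n x)) -> a = b.
  move=> ab; apply: (@mulIg _ b^-1); rewrite mulgV.
  have pair_neq : @iota n (spair (T n) true) <> iota (spair (T n) false).
    by move/iota_inj/spair_neq.
  by apply: (limit_trivial_pair_stabilizers pair_neq);
    rewrite /elt_act [LHS]symM ab; apply: symK.
exists f; split=> [g h|g h gh].
  by apply: ext => x; rewrite symM !fP sactM.
have gh_eq x : sact x g = sact x h by apply: iota_inj; rewrite -!fP gh.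
apply: (@mulIg _ h^-1); rewrite mulgV; apply: (sactS (@spair_neq (T n)));
  by rewrite sactM gh_eq -sactM mulgV sact1.
Qed.

Lemma limit_fixed_point_free : fixed_point_free_involutions limit_act.
Proof.
move=> a y aa ay; apply: elt_ext => w; have [n nP] := eltP a.
have [m [nm [x [x' [_ [yx -> _]]]]]] := iota_common iota_j iota_surj n y w y.
have [g gP] := nP m nm; rewrite [LHS]gP; congr iota.
suff -> : g = 1 by rewrite sact1.
apply: (@sactI _ g x); last by apply: iota_inj; rewrite -gP -yx.
have fixgg k : sact (spair (T m) k) (g * g) = spair (T m) k.
  by apply: iota_inj; rewrite sactM -!gP -symM [_ * _](congr1 (@eltval _ _) aa).
exact: (@sactS _ (g * g) _ _ (@spair_neq _)).
Qed.

(** At a level that contains all four points, both pairs are images of the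
    distinguished pair under elements of the next level. *)
Lemma limit_2_transitive y1 y2 z1 z2 : y1 <> y2 -> z1 <> z2 ->
  exists a, limit_act y1 a = z1 /\ limit_act y2 a = z2.
Proof.
move=> y12 z12.
have [k zk] := iota_eventually iota_j iota_surj z2.
have [m [km [x1 [x2 [v1 [y1E y2E z1E]]]]]] :=
  iota_common iota_j iota_surj k y1 y2 z1.
have [v2 z2E] := zk m km.
have x12 : x1 <> x2 by move=> x12; apply: y12; rewrite y1E x12.
have v12 : v1 <> v2 by move=> v12; apply: z12; rewrite z1E v12.
have [g [g1 g2]] := @j_reaches m _ _ x12.
have [h [h1 h2]] := @j_reaches m _ _ v12.
have [a aP] := induce (g^-1 * h); exists a.
have gh x y z : sact x g = y -> sact x h = z -> sact y (g^-1 * h) = z.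
  by move=> <- <-; rewrite !sactM -(sactM x g) mulgV sact1.
rewrite /elt_act y1E y2E z1E z2E -(iota_j x1) -(iota_j x2) -(iota_j v1).
by rewrite -(iota_j v2) !aP (gh _ _ _ g1 h1) (gh _ _ _ g2 h2).
Qed.

Lemma limit_sharply_2_transitive : sharply_2_transitive limit_act.
Proof.
have pair_neq : iota (spair (T 0) true) <> iota (spair (T 0) false).
  by move/iota_inj/spair_neq.
have other y : exists z : Y, y <> z.
  have [->|] := pselect (y = iota (spair (T 0) true)).
    by exists (iota (spair (T 0) false)).
  by exists (iota (spair (T 0) true)).
split; first exact: elt_actP.
- by exists (iota (spair (T 0) true)), (iota (spair (T 0) false)).
- move=> y z; have [[y' yy'] [z' zz']] := (other y, other z).
  by have [a [ay _]] := limit_2_transitive yy' zz'; exists a.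
move=> y1 y2 z1 z2 y12 z12; have [a [a1 a2]] := limit_2_transitive y12 z12.
exists a; split=> // b [b1 b2]; apply: (@mulIg _ b^-1); rewrite mulgV.
by apply: (limit_trivial_pair_stabilizers y12);
  rewrite (proj2 (@elt_actP _ _)) (a1, a2) -(b1, b2) -(proj2 (@elt_actP _ _))
    mulgV.
Qed.

End Tower.

(** * Abelian normal subgroups *)

(** An abelian transitive group of permutations is regular, and a point where
    an involution s agrees with an element m of it shows that s = m. *)
Lemma no_abelian_normal_subgroup (H : groupType) (X : Type)
    (act : X -> H -> X) (u v : H) :
    sharply_2_transitive act -> fixed_point_free_involutions act ->
    u * u = 1 -> v * v = 1 -> u * v <> v * u ->
  ~ exists N : set H,
      [/\ normal_subgroup N, abelian_subset N & nontrivial_subgroup N].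
Proof.
move=> [[act1 actM] [p0 [q0 pq0]] _ two] fpf uu vv uv.
move=> [N [[[N1 Ndiv] NJ] Nab Nnt]].
have {}N1 : N 1 by move: N1; rewrite inE.
have {}Ndiv x y : N x -> N y -> N (x / y).
  by move=> Nx Ny; have := Ndiv x y; rewrite !inE; apply.
have triv g : (forall x, act x g = x) -> g = 1.
  move=> gx; have [h [_ hu]] := two _ _ _ _ pq0 pq0.
  by rewrite -(hu g) ?(hu 1) // !act1.
have [n Nn n1] : exists2 n, N n & n <> 1.
  apply: contrapT => nex; apply: Nnt; apply/seteqP; split=> x /=.
    by move=> Nx; apply: contrapT => x1; apply: nex; exists x.
  by move->.
(* Two-transitivity conjugates the pair p, p * n to any other pair. *)
have [p pn] : exists p, act p n <> p.
  by apply: contrapT => nex; apply: n1; apply: triv => x; apply: contrapT => xn;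
    apply: nex; exists x.
have trans x y : exists2 m, N m & act x m = y.
  have [->|xy] := pselect (x = y); first by exists 1; rewrite ?act1.
  have [g [[pg png] _]] := two _ _ _ _ (fun e => pn (esym e)) xy.
  exists (n ^ g); first exact: NJ.
  by rewrite conjgE -pg -png -!actM !mulgA mulgV mul1g.
have regular x m : N m -> act x m = x -> m = 1.
  move=> Nm xm; apply: triv => y; have [k Nk <-] := trans x y.
  by rewrite -actM (Nab k m) // actM xm.
have inN s : s * s = 1 -> N s.
  move=> ss; have [m Nm xm] := trans p0 (act p0 s).
  have fixp : act p0 (s * m^-1) = p0 by rewrite actM -xm -actM mulgV act1.
  have sV : s^-1 = s by apply: (@mulgI _ s); rewrite mulgV ss.
  (* The square is (m^-1)^s * m^-1, since s is its own inverse. *)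
  have sm2 : (s * m^-1) * (s * m^-1) = 1.
    apply: (@regular p0); last by rewrite actM !fixp.
    rewrite !mulgA; apply: (Ndiv) => //.
    have := NJ m^-1 s; rewrite conjgE sV mulgA; apply.
    by rewrite -[m^-1]mul1g; apply: Ndiv.
  have /(canRL (mulgVK _)) := fpf _ _ sm2 fixp.
  by rewrite mul1g => ->.
by apply: uv; apply: Nab; apply: inN.
Qed.

(** * The regular action of G x S_3 and its limit *)

Section Start.
Variable G : groupType.
Let G3 : groupType := (G * {perm 'I_3})%type.

Let regular_act (x g : G3) : G3 := x * g.

Let regular_actP : right_action regular_act.
Proof. by split=> [x|x g h]; rewrite /regular_act ?mulg1 ?mulgA. Qed.

Let regular_free x g : regular_act x g = x -> g = 1.
Proof. by rewrite /regular_act -{2}[x]mulg1 => /mulgI. Qed.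

Let regular_pair_stabilizers : trivial_pair_stabilizers regular_act.
Proof. by move=> g x y _ /regular_free. Qed.

Let regular_involutions : fixed_point_free_involutions regular_act.
Proof. by move=> g x _ /regular_free. Qed.

Let t : {perm 'I_3} := tperm ord0 ord_max.

Let t_neq : (1 : G3) <> (1, t).
Proof. by case=> /permP/(_ ord0); rewrite perm1 tpermL. Qed.

Let t_swap : exists s, forall k : bool,
  regular_act (if k then 1 else (1, t)) s = if ~~ k then 1 else (1, t).
Proof.
exists (1, t) => -[]; rewrite /regular_act ?mul1g //.
by congr pair; [exact: mulg1 | exact: tperm2].
Qed.

(** The factor S_3 supplies both the swap of the distinguished pair and the two
    non-commuting involutions that exclude abelian normal subgroups. *)
Definition regular_stage : stage :=
  Stage regular_actP regular_pair_stabilizers regular_involutions t_neq t_swap.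

End Start.

Theorem theorem1p4 (G : groupType) :
  exists (GG : groupType) (i : {multiplicative G -> GG})
         (X : Type) (act : X -> GG -> X),
    [/\ injective i,
        sharply_2_transitive act,
        forall g : GG, involution g -> forall x : X, act x g <> x &
        ~ exists N : set GG,
            [/\ normal_subgroup N, abelian_subset N & nontrivial_subgroup N]].
Proof.
pose step (S : stage) := cid (extension_step S).
pose T := nat_rect (fun=> stage) (regular_stage G) (fun _ S => sval (step S)).
pose j n : T n -> T n.+1 := sval (cid (svalP (step (T n)))).
have jP n : extends (@j n) /\ reaches_pairs (@j n) :=
  svalP (cid (svalP (step (T n)))).
have j_inj n : injective (@j n) by case: (jP n) => -[].
have [Y [iota [iota_inj iota_j iota_surj]]] :=
  colimit_exists j_inj (fun n => spair (T n) true).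
have j_ext n := proj1 (jP n); have j_reach n := proj2 (jP n).
pose K := limit_group iota.
have sharp : sharply_2_transitive (@elt_act Y K) :=
  limit_sharply_2_transitive j_ext j_reach iota_inj iota_j iota_surj.
have fpf : fixed_point_free_involutions (@elt_act Y K) :=
  limit_fixed_point_free iota_inj iota_j iota_surj.
have [f [fM f_inj]] := stage_embeds j_ext iota_inj iota_j iota_surj 0.
have f1 : f 1 = 1 by apply: (@mulIg _ (f 1)); rewrite -fM !mul1g.
pose i (g : G) : elt K := f (g, 1).
have iM : {morph i : g h / g * h}.
  by move=> g h; rewrite -fM /i -[in LHS](mulg1 1).
pose im : {multiplicative G -> elt K} :=
  HB.pack i (isMultiplicative.Build G (elt K) i iM).
exists (elt K), im, Y, (@elt_act Y K); split=> //.
- by move=> g h /f_inj[].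
- move=> g [_ g2 g_order] x gx; apply: (g_order 1%N) => //.
  exact: fpf g2 gx.
pose t01 : {perm 'I_3} := tperm ord0 (lift ord0 ord0).
pose t12 : {perm 'I_3} := tperm (lift ord0 ord0) ord_max.
apply: (@no_abelian_normal_subgroup _ _ _ (f (1, t01)) (f (1, t12)) sharp fpf).
- by rewrite -fM -f1; congr f; congr pair; [exact: mulg1 | exact: tperm2].
- by rewrite -fM -f1; congr f; congr pair; [exact: mulg1 | exact: tperm2].
rewrite -!fM => /f_inj comm.
have /permP/(_ ord0) : t01 * t12 = t12 * t01 by exact: (congr1 snd comm).
have t01_0 : t01 ord0 = lift ord0 ord0 := tpermL _ _.
have t12_1 : t12 (lift ord0 ord0) = ord_max := tpermL _ _.
have t12_0 : t12 ord0 = ord0 by apply: tpermD.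
by rewrite !permM t12_0 t01_0 t12_1.
Qed.
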